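(* Assume the setting below with bounded measurable reward $r$, measurable transition kernel $P$, measurable policy kernel $\pi$, discount $0\le\gamma<1$ and concentration $\kappa>0$. Let $\mathcal{B}_\infty$ be the space of bounded measurable functions $Q:\mathcal{S}\times\mathbb{S}^{m-1}\to\mathbb{R}$ with the sup norm $\|Q\|_\infty=\sup_{\bm{s},\bm{c}}|Q(\bm{s},\bm{c})|$. Define the smoothed Bellman operator \[ (\mathcal{T}_\kappa^\pi Q)(\bm{s},\bm{c})=\mathbb{E}\Big[r\big(\bm{s},\bm{a}^\star(\bm{s},\tilde{\bm{c}})\big)+\gamma\,Q(\bm{s}',\tilde{\bm{c}}')\Big], \] where $\tilde{\bm{c}}\sim K_\kappa(\cdot\mid\bm{c})$, $\bm{s}'\sim P(\cdot\mid\bm{s},\bm{a}^\star(\bm{s},\tilde{\bm{c}}))$, $\bm{c}'\sim\pi(\cdot\mid\bm{s}')$, $\tilde{\bm{c}}'\sim K_\kappa(\cdot\mid\bm{c}')$. Then: (1) $\mathcal{T}_\kappa^\pi$ maps $\mathcal{B}_\infty$ into itself and is a $\gamma$-contraction on $(\mathcal{B}_\infty,\|\cdot\|_\infty)$; hence it has a unique fixed point $Q_\kappa^\pi\in\mathcal{B}_\infty$. (2) For every $Q\in\mathcal{B}_\infty$ and every $\bm{s}\in\mathcal{S}$, the map $\bm{c}\mapsto(\mathcal{T}_\kappa^\pi Q)(\bm{s},\bm{c})$ is $C^\infty$ on $\mathbb{S}^{m-1}$. (3) Consequently, for every $\bm{s}\in\mathcal{S}$, $\bm{c}\mapsto Q_\kappa^\pi(\bm{s},\bm{c})$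 is $C^\infty$ on $\mathbb{S}^{m-1}$.
   Context: Setting: a discounted MDP with measurable state space $\mathcal{S}$; for each state $\bm{s}$ a finite nonempty feasible set $\mathcal{A}(\bm{s})\subseteq\{0,1\}^m$; a solver mapping $\bm{a}^\star(\bm{s},\bm{c})\in\operatorname*{argmin}_{\bm{a}\in\mathcal{A}(\bm{s})}\bm{c}^\top\bm{a}$ (with deterministic, measurable tie-breaking); reward $r(\bm{s},\bm{a})$; transition kernel $P(\cdot\mid\bm{s},\bm{a})$; a policy $\pi(\cdot\mid\bm{s})$ which is a Markov kernel from $\mathcal{S}$ to the unit sphere $\mathbb{S}^{m-1}=\{\bm{c}\in\mathbb{R}^m:\|\bm{c}\|_2=1\}$. The von Mises–Fisher kernel with concentration $\kappa>0$ is the probability density on $\mathbb{S}^{m-1}$ (w.r.t. surface measure $\sigma$) given by $K_\kappa(\tilde{\bm{c}}\mid\bm{c})=C_m(\kappa)\exp(\kappa\,\bm{c}^\top\tilde{\bm{c}})$, with $C_m(\kappa)$ the normalizing constant. *)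

(* Defs.v *)
From HB Require Import structures.
From mathcomp Require Import all_boot all_order all_algebra.
From mathcomp Require Import all_classical all_reals all_analysis.
From mathcomp Require Import measurable_realfun.
Set Implicit Arguments. Unset Strict Implicit. Unset Printing Implicit Defensive.
Import Order.TTheory GRing.Theory Num.Theory.
Import numFieldNormedType.Exports.
Local Open Scope classical_set_scope.
Local Open Scope ring_scope.

Section SmoothedBellman.
Variables (R : realType) (m : nat).

Definition dotv (x y : 'rV[R]_m) : R := \sum_(i < m) x 0 i * y 0 i.

Definition sphere : set 'rV[R]_m := [set c | dotv c c = 1].

Definition action := {ffun 'I_m -> bool}.
Definition actv (a : action) : 'rV[R]_m := \row_(i < m) (a i)%:R.

(* Borel sigma-algebra on R^m, generated by the coordinate maps *)
Definition coord_gen : set (set 'rV[R]_m) :=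
  [set A | exists (i : 'I_m) (B : set R), measurable B /\
           A = [set x : 'rV[R]_m | B (x 0 i)]].
Definition mvec := g_sigma_algebraType coord_gen.

Definition evec (i : 'I_m) : 'rV[R]_m := delta_mx 0 i.

Fixpoint iter_partial (l : seq 'I_m) (g : 'rV[R]_m -> R) : 'rV[R]_m -> R :=
  match l with
  | [::] => g
  | i :: l' => fun x => derive (iter_partial l' g) x (evec i)
  end.

Definition smooth_on (U : set 'rV[R]_m) (g : 'rV[R]_m -> R) : Prop :=
  forall l : seq 'I_m,
    (forall x, U x -> {for x, continuous (iter_partial l g)}) /\
    (forall (i : 'I_m) x, U x -> derivable (iter_partial l g) x (evec i)).

Definition smooth_on_sphere (f : 'rV[R]_m -> R) : Prop :=
  forall c, sphere c ->
    exists (U : set 'rV[R]_m) (g : 'rV[R]_m -> R),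
      [/\ open U, U c, smooth_on U g & forall x, U x -> sphere x -> g x = f x].

Definition orthogonal_mx (O : 'M[R]_m) : Prop := O *m O^T = 1%:M.

(* sigma is a (positive scalar multiple of the) surface measure on S^{m-1}:
   a nonzero finite Borel measure on R^m carried by the sphere and invariant
   under the orthogonal group (these determine surface measure up to a
   positive constant factor). *)
Definition surface_measure_like (sigma : {measure set mvec -> \bar R}) : Prop :=
  [/\ sigma (~` (sphere : set mvec)) = 0%E,
      (0 < sigma (sphere : set mvec))%E,
      (sigma (sphere : set mvec) < +oo)%E &
      forall O : 'M[R]_m, orthogonal_mx O ->
        forall A : set mvec, measurable A ->
          sigma [set x : mvec | A (x *m O)] = sigma A].

Variables (d : measure_display) (S : measurableType d).

Definition inB (Q : S * mvec -> R) : Prop :=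
  measurable_fun (setT `*` (sphere : set mvec)) Q /\
  exists M : R, forall s c, sphere c -> `|Q (s, c)| <= M.

Definition supnorm (Q : S * mvec -> R) : R :=
  sup [set `|Q (s, c)| | s in setT & c in (sphere : set mvec)].

Variable sigma : {measure set mvec -> \bar R}.
Variable kappa : R.

(* von Mises--Fisher kernel: density C(kappa) exp(kappa c^T x) w.r.t. sigma on
   the sphere, C(kappa) being the normalizing constant *)
Definition vmf_norm (c : mvec) : R :=
  \int[sigma]_(x in (sphere : set mvec)) expR (kappa * dotv c x).

Definition vmf_expect (c : mvec) (f : mvec -> R) : R :=
  (vmf_norm c)^-1 *
  \int[sigma]_(x in (sphere : set mvec)) (expR (kappa * dotv c x) * f x).

Variables (astar : S -> mvec -> action) (r : S -> action -> R)
  (P : S -> action -> probability S R) (pi : S -> probability mvec R)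
  (gamma : R).

Definition bellman (Q : S * mvec -> R) (sc : S * mvec) : R :=
  vmf_expect sc.2 (fun ct =>
    r sc.1 (astar sc.1 ct) +
    gamma * \int[P sc.1 (astar sc.1 ct)]_(s' in setT)
              \int[pi s']_(c' in setT) vmf_expect c' (fun ct' => Q (s', ct'))).

End SmoothedBellman.

(* Main.v *)
(* The operator factors as T Q (s, c) = E_{x ~ K_kappa(.|c)}[f_Q (s, x)], where
   f_Q is bounded and measurable.  Averages are 1-Lipschitz in the sup norm, so
   the factor gamma in f_Q makes T a contraction, and the iterates of T starting
   at 0 converge geometrically to the fixed point.  The von Mises-Fisher average
   of any bounded measurable f is the quotient N(c)^-1 * I_f(c) with
   I_f(c) = int exp(kappa c.x) f(x) dsigma and N = I_1; it extends to all of R^m,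
   and differentiation under the integral sign gives d_i I_f = I_{kappa x_i f}.
   So no regularity of f_Q (hence of the solver) is needed for smoothness. *)
Require Import Defs.
From HB Require Import structures.
From mathcomp Require Import all_boot all_order all_algebra.
From mathcomp Require Import all_classical all_reals all_analysis.
From mathcomp Require Import measurable_realfun.
From mathcomp Require Import ring lra.
Import Order.TTheory GRing.Theory Num.Theory.
Import numFieldNormedType.Exports.
Local Open Scope classical_set_scope.
Local Open Scope ring_scope.

Set Implicit Arguments.
Unset Strict Implicit.

(** * Bounded integrands *)

Lemma bounded_measurable_integrable (R : realType) (d : measure_display)
    (T : measurableType d) (mu : {measure set T -> \bar R}) (D : set T)
    (f : T -> R) (M : R) :
  measurable D -> (mu D < +oo)%E -> measurable_fun D f ->
  (forall x, D x -> `|f x| <= M) -> mu.-integrable D (EFin \o f).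
Proof.
move=> mD muD mf fM; apply: measurable_bounded_integrable => //.
exists M; split; first exact: num_real.
by move=> K MK x Dx; apply: le_trans (fM x Dx) (ltW MK).
Qed.

(** Measurability in the parameter is known for bundled finite kernels and nonnegative extended-real
    integrands. This transfers it to a bare family of measures and a signed integrand on [D], a form
    that serves [sigma], [pi] and [P] alike. *)
Lemma measurable_Rintegral_finite_kernel (R : realType)
    (d1 d2 : measure_display) (X : measurableType d1) (Y : measurableType d2)
    (l : X -> {measure set Y -> \bar R}) (D : set Y) (f : X * Y -> R) :
  (forall U, measurable U -> measurable_fun setT (fun x => l x U)) ->
  (exists C : R, forall x, (l x setT < C%:E)%E) ->
  measurable D -> measurable_fun (setT `*` D) f ->
  measurable_fun setT (fun x => \int[l x]_(y in D) f (x, y)).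
Proof.
move=> ml lC mD mf.
pose l' : X -> {measure set Y -> \bar R} := l.
pose K1 := isKernel.Build _ _ X Y R l' ml.
pose k0 : R.-ker X ~> Y := HB.pack l' K1.
pose K2 := Kernel_isFinite.Build _ _ X Y R k0 lC.
pose k : R.-fker X ~> Y := HB.pack l' K1 K2.
have mf' : measurable_fun setT (EFin \o (f \_ (setT `*` D))).
  apply/measurable_EFinP; apply: (measurable_restrictT f _).1 => //.
  exact: measurableX.
(* With [f] extended by zero outside [D], the integral is [fine] of a difference of two nonnegative
   integrals, each measurable in [x]; [fine] is measurable too, so infinite values do no harm. *)
have -> : (fun x => \int[l x]_(y in D) f (x, y)) =
   (fun x => fine ((\int[k x]_y ((EFin \o (f \_ (setT `*` D)))^\+ (x, y))) -
     (\int[k x]_y ((EFin \o (f \_ (setT `*` D)))^\- (x, y))))%E).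
  apply/funext => x; rewrite Rintegral_mkcond /Rintegral integralE.
  by congr (fine (_ - _)); apply: eq_integral => y _;
     rewrite ?funeposE ?funenegE /= /patch in_setX in_setT.
apply: measurableT_comp; first exact: fine_measurable.
apply: emeasurable_funB.
  by apply: (measurable_fun_integral_finite_kernel _ k) => //; exact: measurable_funepos.
by apply: (measurable_fun_integral_finite_kernel _ k) => //; exact: measurable_funeneg.
Qed.

Lemma normr_Rintegral_probability_le (R : realType) (d : measure_display)
    (T : measurableType d) (p : probability T R) (f : T -> R) (M : R) :
  measurable_fun setT f -> (forall x, `|f x| <= M) ->
  `|\int[p]_(x in setT) f x| <= M.
Proof.
move=> mf fM.
have pfin : (p setT < +oo)%E by rewrite probability_setT ltry.
have fi : p.-integrable setT (EFin \o f).
  exact: (@bounded_measurable_integrable _ _ _ _ _ _ M).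
apply: (le_trans (le_normr_Rintegral measurableT fi)).
have -> : M = \int[p]_(x in setT) M.
  by rewrite Rintegral_cst// [X in fine X]probability_setT mulr1.
apply: le_Rintegral => //.
- by apply: (@bounded_measurable_integrable _ _ _ _ _ _ M) => //;
    [exact: measurableT_comp|move=> x _; rewrite normr_id].
- exact: (@bounded_measurable_integrable _ _ _ _ _ _ `|M|).
Qed.

Lemma Rintegral_probability_dist_le (R : realType) (d : measure_display)
    (T : measurableType d) (p : probability T R) (f g : T -> R) (Mf Mg D : R) :
  measurable_fun setT f -> (forall x, `|f x| <= Mf) ->
  measurable_fun setT g -> (forall x, `|g x| <= Mg) ->
  (forall x, `|f x - g x| <= D) ->
  `|\int[p]_(x in setT) f x - \int[p]_(x in setT) g x| <= D.
Proof.
move=> mf fM mg gM fgD.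
have pfin : (p setT < +oo)%E by rewrite probability_setT ltry.
rewrite -RintegralB//; last 2 first.
- exact: (@bounded_measurable_integrable _ _ _ _ _ _ Mf).
- exact: (@bounded_measurable_integrable _ _ _ _ _ _ Mg).
by apply: normr_Rintegral_probability_le => //; exact: measurable_funB.
Qed.

(** * Measurability and coordinate bounds on the sphere *)

Section sphere.
Variables (R : realType) (m : nat).
Local Notation V := (mvec R m).
Local Notation sph := (@sphere R m : set V).

Lemma measurable_coord (i : 'I_m) : measurable_fun setT (fun x : V => x 0 i).
Proof.
move=> _ B mB; rewrite setTI; apply: sub_sigma_algebra.
by exists i, B.
Qed.

Lemma measurable_dotv :
  measurable_fun setT (fun cx : V * V => dotv cx.1 cx.2).
Proof.
apply: measurable_sum => i; apply: measurable_funM.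
- by apply: (@measurableT_comp _ _ _ _ _ _ (fun x : V => x 0 i));
    [exact: measurable_coord|exact: measurable_fst].
- by apply: (@measurableT_comp _ _ _ _ _ _ (fun x : V => x 0 i));
    [exact: measurable_coord|exact: measurable_snd].
Qed.

Lemma measurable_dotvr (c : V) : measurable_fun setT (fun x : V => dotv c x).
Proof.
exact: (measurableT_comp measurable_dotv (pair1_measurable c)).
Qed.

Lemma measurable_sphere : measurable (sph : set V).
Proof.
have m1 : measurable_fun setT (fun x : V => dotv x x).
  apply: (measurableT_comp measurable_dotv (g := fun x : V => (x, x))).
  exact: measurable_fun_pair.
by have := m1 measurableT _ (measurable_set1 (1 : R)); rewrite setTI.
Qed.

Lemma sphere_coord_le1 (x : 'rV[R]_m) (i : 'I_m) : sphere x -> `|x 0 i| <= 1.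
Proof.
move=> sx; rewrite -(@ler_pXn2r _ 2)// ?nnegrE// expr1n real_normK ?num_real//.
rewrite -sx /dotv (bigD1 i)//= -expr2 lerDl.
by apply: sumr_ge0 => j _; rewrite -expr2 sqr_ge0.
Qed.

(** The l1 norm of [c] is a cruder bound than Cauchy-Schwarz gives, but it follows coordinatewise
    and holds for every [c] in R^m, to which the averages are extended. *)
Lemma dotv_sphere_le (c x : 'rV[R]_m) :
  sphere x -> `|dotv c x| <= \sum_(i < m) `|c 0 i|.
Proof.
move=> sx; apply: (le_trans (ler_norm_sum _ _ _)).
apply: ler_sum => i _; rewrite normrM ler_piMr//.
exact: sphere_coord_le1.
Qed.

Lemma dotvDl (b c x : 'rV[R]_m) : dotv (b + c) x = dotv b x + dotv c x.
Proof.
by rewrite /dotv -big_split; apply: eq_bigr => i _; rewrite mxE mulrDl.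
Qed.

Lemma dotvBl (b c x : 'rV[R]_m) : dotv (b - c) x = dotv b x - dotv c x.
Proof.
by rewrite /dotv -sumrB; apply: eq_bigr => i _; rewrite !mxE mulrBl.
Qed.

Lemma dotv_evec (h : R) (i : 'I_m) (x : 'rV[R]_m) :
  dotv (h *: evec R i) x = h * x 0 i.
Proof.
rewrite /dotv (bigD1 i)//= !mxE !eqxx mulr1 big1 ?addr0// => j ji.
by rewrite !mxE eqxx (negbTE ji) mulr0 mul0r.
Qed.

End sphere.

(** * Averages against the von Mises-Fisher kernel *)

Section vmf.
Variables (R : realType) (m : nat).
Local Notation V := (mvec R m).
Local Notation sph := (@sphere R m : set V).
Variables (sigma : {measure set V -> \bar R}) (kappa : R).
Hypothesis sigmaC0 : sigma (~` sph) = 0%E.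
Hypothesis sigma_gt0 : (0 < sigma sph)%E.
Hypothesis sigma_ltoo : (sigma sph < +oo)%E.

Let msph : measurable sph := @measurable_sphere R m.

Lemma expR_dotv_le (c x : 'rV[R]_m) : sphere x ->
  expR (kappa * dotv c x) <= expR (`|kappa| * \sum_(i < m) `|c 0 i|).
Proof.
move=> sx; rewrite ler_expR; apply: (le_trans (ler_norm _)).
by rewrite normrM ler_wpM2l// dotv_sphere_le.
Qed.

Lemma measurable_expR_dotv (c : V) :
  measurable_fun setT (fun x : V => expR (kappa * dotv c x)).
Proof.
apply: measurableT_comp => //; apply: measurable_funM => //.
exact: measurable_dotvr.
Qed.

Lemma vmf_integrable (c : V) (f : V -> R) (M : R) :
  measurable_fun sph f -> (forall x, sph x -> `|f x| <= M) ->
  sigma.-integrable sph (EFin \o (fun x => expR (kappa * dotv c x) * f x)).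
Proof.
move=> mf fM.
apply: (@bounded_measurable_integrable _ _ _ _ _ _
  (expR (`|kappa| * \sum_(i < m) `|c 0 i|) * M)) => //.
  apply: measurable_funM => //; apply: measurable_funTS.
  exact: measurable_expR_dotv.
move=> x sx; rewrite normrM ler_pM// ?fM//.
by rewrite ger0_norm ?expR_ge0// expR_dotv_le.
Qed.

(** Puts the normalizing constant among the weighted integrals, as the case f = 1. *)
Lemma vmf_normE (c : V) :
  vmf_norm sigma kappa c = \int[sigma]_(x in sph) (expR (kappa * dotv c x) * 1).
Proof. by apply: eq_Rintegral => x _; rewrite mulr1. Qed.

(** On the sphere the integrand is at least the positive constant [B], and the sphere has positive
    finite mass. *)
Lemma vmf_norm_gt0 (c : V) : 0 < vmf_norm sigma kappa c.
Proof.
rewrite vmf_normE; set B := expR (- (`|kappa| * \sum_(i < m) `|c 0 i|)).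
apply: (@lt_le_trans _ _ (\int[sigma]_(x in sph) B)).
  rewrite Rintegral_cst// mulr_gt0 ?expR_gt0// fine_gt0//.
  by rewrite sigma_gt0 sigma_ltoo.
apply: le_Rintegral => //.
- exact: (@bounded_measurable_integrable _ _ _ _ _ _ `|B|).
- exact: (@vmf_integrable _ _ `|1|).
- move=> x sx; rewrite mulr1 ler_expR lerNl; apply: le_trans (ler_norm _) _.
  by rewrite normrN normrM ler_wpM2l// dotv_sphere_le.
Qed.

(** The density is positive with total mass one: once the denominator is cleared, the integral of
    the weighted f is compared with M times the normalizing constant. *)
Lemma normr_vmf_expect_le (c : V) (f : V -> R) (M : R) :
  measurable_fun sph f -> (forall x, sph x -> `|f x| <= M) ->
  `|vmf_expect sigma kappa c f| <= M.
Proof.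
move=> mf fM; have N0 := vmf_norm_gt0 c.
rewrite /vmf_expect normrM gtr0_norm ?invr_gt0// ler_pdivrMl// mulrC.
have fi := vmf_integrable c mf fM.
apply: (le_trans (le_normr_Rintegral msph fi)).
rewrite vmf_normE -RintegralZl//; last exact: (@vmf_integrable _ _ `|1|).
apply: le_Rintegral => //.
- have -> : EFin \o (fun x => `|expR (kappa * dotv c x) * f x|) =
      abse \o (EFin \o (fun x => expR (kappa * dotv c x) * f x)) by [].
  exact: integrable_abse.
- have -> : (fun x => M * (expR (kappa * dotv c x) * 1)) =
      (fun x => expR (kappa * dotv c x) * M).
    by apply/funext => x; rewrite mulr1 mulrC.
  exact: (@vmf_integrable _ (fun=> M) `|M|).
- move=> x sx; rewrite normrM ger0_norm ?expR_ge0// mulr1 mulrC.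
  by rewrite ler_wpM2r ?expR_ge0// fM.
Qed.

Lemma vmf_expectB (c : V) (f g : V -> R) (Mf Mg : R) :
  measurable_fun sph f -> (forall x, sph x -> `|f x| <= Mf) ->
  measurable_fun sph g -> (forall x, sph x -> `|g x| <= Mg) ->
  vmf_expect sigma kappa c f - vmf_expect sigma kappa c g =
  vmf_expect sigma kappa c (fun x => f x - g x).
Proof.
move=> mf fM mg gM; rewrite /vmf_expect -mulrBr -RintegralB//.
- by congr (_ * _); apply: eq_Rintegral => x _; rewrite mulrBr.
- exact: (vmf_integrable _ _ fM).
- exact: (vmf_integrable _ _ gM).
Qed.

Lemma vmf_expect_dist_le (c : V) (f g : V -> R) (Mf Mg D : R) :
  measurable_fun sph f -> (forall x, sph x -> `|f x| <= Mf) ->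
  measurable_fun sph g -> (forall x, sph x -> `|g x| <= Mg) ->
  (forall x, sph x -> `|f x - g x| <= D) ->
  `|vmf_expect sigma kappa c f - vmf_expect sigma kappa c g| <= D.
Proof.
move=> mf fM mg gM fgD; rewrite (vmf_expectB _ mf fM mg gM).
by apply: normr_vmf_expect_le => //; exact: measurable_funB.
Qed.

Lemma measurable_vmf_integral (d : measure_display) (S : measurableType d)
    (Q : S * V -> R) :
  measurable_fun (setT `*` sph) Q ->
  measurable_fun setT (fun sc : S * V =>
    \int[sigma]_(x in sph) (expR (kappa * dotv sc.2 x) * Q (sc.1, x))).
Proof.
move=> mQ.
apply: (@measurable_Rintegral_finite_kernel _ _ _ _ _ (fun=> sigma) sph
  (fun p : (S * V) * V => expR (kappa * dotv p.1.2 p.2) * Q (p.1.1, p.2))) => //.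
  (* A finite kernel needs finite mass on the whole space; the complement of the sphere is null. *)
  have sfin : (sigma setT < +oo)%E.
    rewrite -(setUv sph) measureU//; last 2 first.
    - exact: measurableC.
    - exact: setICr.
    by rewrite [X in (_ + X)%E]sigmaC0 adde0.
  (* The bound on a finite kernel is strict, hence the added 1. *)
  exists (fine (sigma setT) + 1) => _.
  by rewrite EFinD fineK ?ge0_fin_numE// lteDl ?ge0_fin_numE ?lte01.
apply: measurable_funM.
  apply: measurable_funTS; apply: measurableT_comp => //.
  apply: measurable_funM => //.
  apply: (measurableT_comp (@measurable_dotv R m)
    (g := fun p : (S * V) * V => (p.1.2, p.2))).
  apply: measurable_fun_pair => //.
  by apply: measurableT_comp => //; exact: measurable_fst.
have mg : measurable_fun setT (fun p : (S * V) * V => (p.1.1, p.2)).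
  apply: measurable_fun_pair => //.
  by apply: measurableT_comp => //; exact: measurable_fst.
apply: (measurable_comp (F := setT `*` sph) _ _ mQ).
- exact: measurableX.
- by move=> _ [[[s c] x] [_ sx] <-].
- exact: measurable_funTS.
Qed.

Lemma measurable_vmf_expect (d : measure_display) (S : measurableType d)
    (Q : S * V -> R) :
  measurable_fun (setT `*` sph) Q ->
  measurable_fun setT (fun sc : S * V =>
    vmf_expect sigma kappa sc.2 (fun x => Q (sc.1, x))).
Proof.
move=> mQ; apply: measurable_funM; last exact: measurable_vmf_integral.
(* By positivity the inverse is a real power, and [powR] is measurable in its base. *)
have -> : (fun sc : S * V => (vmf_norm sigma kappa sc.2)^-1) =
    (fun sc => (vmf_norm sigma kappa sc.2) `^ (-1)).
  by apply/funext => sc; rewrite powR_inv1// ltW// vmf_norm_gt0.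
apply: (measurableT_comp (measurable_powR (-1))).
have := @measurable_vmf_integral _ S (fun=> 1) (@measurable_cst _ _ _ _ _ _).
by under [X in _ _ X]eq_fun do rewrite -vmf_normE.
Qed.

Lemma measurable_xsection_sphere (d : measure_display) (S : measurableType d)
    (Q : S * V -> R) (s : S) :
  measurable_fun (setT `*` sph) Q -> measurable_fun sph (fun x => Q (s, x)).
Proof.
move=> mQ; apply: (measurable_comp (F := setT `*` sph) _ _ mQ).
- exact: measurableX.
- by move=> _ [x sx <-].
- by apply: measurable_funTS; exact: pair1_measurable.
Qed.

End vmf.

(** * Smoothness of the averages *)

(** The integrand along a coordinate line through c has this form, with a = kappa y_i, b = kappa c.y
    and k = f(y). *)
Lemma is_derive_expR_affine (R : realType) (a b k x : R) :
  is_derive x (1 : R) (fun h => expR (h * a + b) * k) (expR (x * a + b) * (a * k)).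
Proof.
have H1 : is_derive x (1 : R) (fun h : R => h * a + b) a.
  have -> : (fun h : R => h * a + b) = (a \*: id) + cst b.
    by apply/funext => h; rewrite !fctE /= mulrC.
  by apply: is_derive_eq; rewrite addr0 [a *: 1]mulr1.
have -> : (fun h => expR (h * a + b) * k) = k \*: (expR \o (fun h => h * a + b)).
  by apply/funext => h; rewrite /= mulrC.
by apply: is_derive_eq; rewrite [_ *: _]mulrC -mulrA.
Qed.

(** With t = a - b this is |e^t - 1| <= e^|t| - 1. For t < 0 it says e^t + e^(-t) >= 2, the sum of
    the tangent bounds e^t >= 1 + t and e^(-t) >= 1 - t. *)
Lemma expR_dist_le (R : realType) (a b : R) :
  `|expR a - expR b| <= expR b * (expR `|a - b| - 1).
Proof.
have -> : expR a - expR b = expR b * (expR (a - b) - 1).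
  by rewrite mulrBr mulr1 -expRD subrKC.
rewrite normrM (ger0_norm (expR_ge0 b)) ler_wpM2l ?expR_ge0//.
move: (a - b) => t; have [t0|t0] := leP 0 t.
  by rewrite (ger0_norm t0) ger0_norm// subr_ge0 -expR0 ler_expR.
rewrite (ltr0_norm t0) ler0_norm; last by rewrite subr_le0 expR_le1 ltW.
have H1 := expR_ge1Dx t; have H2 := expR_ge1Dx (- t).
rewrite opprB; lra.
Qed.

Section smooth.
Variables (R : realType) (m : nat).
Local Notation V := (mvec R m).
Local Notation sph := (@sphere R m : set V).
Variables (sigma : {measure set V -> \bar R}) (kappa : R).
Hypothesis sigma_gt0 : (0 < sigma sph)%E.
Hypothesis sigma_ltoo : (sigma sph < +oo)%E.

Let msph : measurable sph := @measurable_sphere R m.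

(** The unnormalized average I_f. Its argument is typed as a row vector, the type that carries the
    topology and the derivatives. *)
Definition vmf_integral (f : V -> R) (c : 'rV[R]_m) : R :=
  \int[sigma]_(x in sph) (expR (kappa * dotv c x) * f x).

Let n1 (b : 'rV[R]_m) : R := \sum_(i < m) `|b 0 i|.

(** The pointwise estimate [expR_dist_le] is made uniform over the sphere by the l1 bound, then
    integrated as a constant. The last factor vanishes as b tends to c, which gives continuity. *)
Lemma vmf_integral_dist_le (f : V -> R) (M : R) (b c : 'rV[R]_m) :
  measurable_fun sph f -> (forall x, sph x -> `|f x| <= M) ->
  `|vmf_integral f b - vmf_integral f c| <=
  expR (`|kappa| * n1 c) * `|M| * fine (sigma sph) *
    (expR (`|kappa| * n1 (b - c)) - 1).
Proof.
move=> mf fM.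
have ib b' := @vmf_integrable _ _ sigma kappa sigma_ltoo b' f M mf fM.
have idiff : sigma.-integrable sph (EFin \o (fun x =>
    expR (kappa * dotv b x) * f x - expR (kappa * dotv c x) * f x)).
  exact: eq_integrable (integrableB msph (ib b) (ib c)).
rewrite /vmf_integral -RintegralB//.
apply: le_trans (le_normr_Rintegral msph idiff) _.
set B := expR (`|kappa| * n1 c) * (expR (`|kappa| * n1 (b - c)) - 1) * `|M|.
have -> : expR (`|kappa| * n1 c) * `|M| * fine (sigma sph) *
    (expR (`|kappa| * n1 (b - c)) - 1) = \int[sigma]_(x in sph) B.
  by rewrite Rintegral_cst// /B; ring.
apply: le_Rintegral => //.
- exact: eq_integrable (integrable_abse idiff).
- exact: (@bounded_measurable_integrable _ _ _ _ _ _ `|B|).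
- move=> x sx; rewrite -mulrBl normrM; apply: ler_pM => //.
    apply: le_trans (expR_dist_le _ _) _.
    apply: ler_pM; [exact: expR_ge0| |exact: expR_dotv_le|].
      by rewrite subr_ge0 -expR0 ler_expR.
    rewrite lerD2r ler_expR -mulrBr -dotvBl normrM ler_wpM2l//.
    exact: dotv_sphere_le.
  by apply: le_trans (fM x sx) _; rewrite ler_norm.
Qed.

Let continuous_n1B (a : 'rV[R]_m) : continuous (fun b : 'rV[R]_m => n1 (b - a)).
Proof.
apply: continuous_big => [|i _]; first exact: add_continuous.
have -> : (fun b : 'rV[R]_m => `|(b - a) 0 i|) =
    Num.norm \o ((fun b : 'rV[R]_m => b 0 i) - cst (a 0 i)).
  by apply/funext => b; rewrite /= !mxE.
move=> c; apply: continuous_comp; last exact: norm_continuous.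
by apply: continuousB; [exact: coord_continuous|exact: cst_continuous].
Qed.

Lemma continuous_vmf_integral (f : V -> R) (M : R) :
  measurable_fun sph f -> (forall x, sph x -> `|f x| <= M) ->
  continuous (vmf_integral f).
Proof.
move=> mf fM c; pose C := expR (`|kappa| * n1 c) * `|M| * fine (sigma sph).
pose h (t : R) := C * (expR (`|kappa| * t) - 1).
have ch : continuous h.
  move=> t; apply: cvgM; first exact: cvg_cst.
  apply: cvgB; last exact: cvg_cst.
  apply: continuous_cvg; first exact: continuous_expR.
  by apply: cvgM; [exact: cvg_cst|exact: cvg_id].
have h0 : {for c, continuous (h \o (fun b => n1 (b - c)))}.
  by apply: continuous_comp; [exact: continuous_n1B|exact: ch].
have hc : h (n1 (c - c)) = 0.
  rewrite /h subrr /n1 big1 ?mulr0 ?expR0 ?subrr ?mulr0// => i _.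
  by rewrite mxE normr0.
have Fc : Filter (nbhs c) := nbhs_filter (c : 'rV[R]_m).
apply/cvgrPdist_le => e e0; move/cvgrPdist_le : h0 => /(_ e e0).
apply: filterS => b; rewrite /= hc sub0r normrN => hb; rewrite distrC.
apply: le_trans (vmf_integral_dist_le b c mf fM) _.
exact: le_trans (ler_norm _) hb.
Qed.

(** Differentiation under the integral sign along the line h e_i + c, at h = 0; the parameter h
    ranges over ]-1, 1[. *)
Lemma is_derive_vmf_integral (f : V -> R) (M : R) (i : 'I_m) (c : 'rV[R]_m) :
  measurable_fun sph f -> (forall x, sph x -> `|f x| <= M) ->
  is_derive c (evec R i) (vmf_integral f)
    (vmf_integral (fun x => kappa * x 0 i * f x) c).
Proof.
move=> mf fM.
pose F (h : R) (y : V) := expR (h * (kappa * y 0 i) + kappa * dotv c y) * f y.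
have FE h y : expR (kappa * dotv (h *: evec R i + c) y) * f y = F h y.
  by rewrite /F dotvDl dotv_evec mulrDr mulrCA.
have dF y h : is_derive h (1 : R) (F^~ y)
    (expR (h * (kappa * y 0 i) + kappa * dotv c y) * (kappa * y 0 i * f y)).
  exact: is_derive_expR_affine.
have d1F h y : partial1of2 F h y =
    expR (kappa * dotv (h *: evec R i + c) y) * (kappa * y 0 i * f y).
  have [_ e] := dF y h.
  by rewrite partial1of2E e dotvDl dotv_evec mulrDr (mulrCA kappa h).
(* A constant dominating function: for |h| <= 1 and y on the sphere, |h y_i| <= 1 accounts for the 1
   in the exponent, and the factor kappa y_i f(y) is at most |kappa| |M|. *)
pose G (y : V) := expR (`|kappa| * (1 + \sum_(j < m) `|c 0 j|)) * (`|kappa| * `|M|).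
have cvgF : h^-1 *: (vmf_integral f (h *: evec R i + c) - vmf_integral f c)
    @[h --> 0^'] --> vmf_integral (fun x => kappa * x 0 i * f x) c.
  have -> : vmf_integral (fun x => kappa * x 0 i * f x) c =
      \int[sigma]_(y in sph) partial1of2 F 0 y.
    by apply: eq_Rintegral => y _; rewrite d1F scale0r add0r.
  (* The difference quotient is recast as that of a function of h at the point 0, hence the
     [h + 0]. *)
  have -> : (fun h : R => h^-1 *: (vmf_integral f (h *: evec R i + c) - vmf_integral f c)) =
     (fun h : R => h^-1 *: ((fun h => \int[sigma]_(y in sph) F h y) (h + 0) -
       (fun h => \int[sigma]_(y in sph) F h y) 0)).
    apply/funext => h; congr (_ *: (_ - _)); apply: eq_Rintegral => y _.
      by rewrite -FE addr0.
    by rewrite -FE scale0r add0r.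
  apply: (@cvg_differentiation_under_integral _ _ _ sigma F sph msph 0 (-1) 1
    _ _ _ G).
  - by rewrite /= in_itv/= ltrN10 ltr01.
  - move=> h _.
    have := @vmf_integrable _ _ sigma kappa sigma_ltoo (h *: evec R i + c) f M mf fM.
    by apply: eq_integrable => // y _ /=; rewrite FE.
  - by move=> h y _ _; have [] := dF y h.
  - by move=> y; rewrite !mulr_ge0 ?expR_ge0.
  - apply: (@bounded_measurable_integrable _ _ _ _ _ _ `|G 0|) => //.
    exact: measurable_cst.
  - move=> h y; rewrite /= in_itv/= => /andP[h1 h2] sy.
    rewrite d1F /G normrM ger0_norm ?expR_ge0//.
    rewrite ler_pM ?expR_ge0//.
      rewrite ler_expR; apply: le_trans (ler_norm _) _.
      rewrite normrM ler_wpM2l// dotvDl dotv_evec.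
      apply: le_trans (ler_normD _ _) _; rewrite lerD ?dotv_sphere_le//.
      rewrite normrM mulr_ile1 ?sphere_coord_le1//.
      by rewrite ler_norml !ltW.
    rewrite normrM ler_pM//; last by apply: le_trans (fM y sy) _; rewrite ler_norm.
    by rewrite normrM ler_piMr// sphere_coord_le1.
apply: DeriveDef; last exact: cvg_lim cvgF.
by apply/cvg_ex; eexists; exact: cvgF.
Qed.

(* Closed under partial derivatives, because d(1/N) = -dN * (1/N) * (1/N). *)
Inductive vmf_smooth : ('rV[R]_m -> R) -> Prop :=
| vmf_smooth_int (f : V -> R) (M : R) :
    measurable_fun sph f -> (forall x, sph x -> `|f x| <= M) ->
    vmf_smooth (vmf_integral f)
| vmf_smooth_inv : vmf_smooth (fun c => (vmf_norm sigma kappa c)^-1)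
| vmf_smoothD g h : vmf_smooth g -> vmf_smooth h -> vmf_smooth (g + h)
| vmf_smoothM g h : vmf_smooth g -> vmf_smooth h -> vmf_smooth (g * h).

Let vmf_norm_int : vmf_norm sigma kappa = vmf_integral (fun=> 1).
Proof. by apply/funext => c; rewrite vmf_normE. Qed.

Let vmf_norm_neq0 (c : V) : vmf_norm sigma kappa c != 0.
Proof. by rewrite gt_eqF// vmf_norm_gt0. Qed.

Let measurable1 : measurable_fun sph (fun=> 1 : R).
Proof. by []. Qed.

Let bounded1 x : sph x -> `|1 : R| <= 1.
Proof. by rewrite normr1. Qed.

Lemma continuous_vmf_smooth g : vmf_smooth g -> continuous g.
Proof.
elim=> [f M mf fM||h1 h2 _ c1 _ c2|h1 h2 _ c1 _ c2].
- exact: continuous_vmf_integral fM.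
- rewrite vmf_norm_int => c; apply: continuousV; first by rewrite -vmf_norm_int.
  exact: (continuous_vmf_integral measurable1 bounded1).
- by move=> c; apply: continuousD; [exact: c1|exact: c2].
- by move=> c; apply: continuousM; [exact: c1|exact: c2].
Qed.

(** Induction on the class: an integral passes to the weight kappa x_i f, again bounded and
    measurable on the sphere since |x_i| <= 1; sums and products follow the usual rules. *)
Lemma derive_vmf_smooth g (i : 'I_m) : vmf_smooth g ->
  exists2 g', vmf_smooth g' & forall c, is_derive c (evec R i) g (g' c).
Proof.
have mcoef k f : measurable_fun sph f ->
    measurable_fun sph (fun x : V => k * x 0 i * f x).
  move=> mf; apply: measurable_funM => //; apply: measurable_funM => //.
  by apply: measurable_funTS; exact: measurable_coord.
have bcoef k f M : (forall x, sph x -> `|f x| <= M) ->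
    forall x, sph x -> `|k * x 0 i * f x| <= `|k| * M.
  move=> fM x sx; rewrite normrM ler_pM ?fM// normrM ler_piMr//.
  exact: sphere_coord_le1.
elim=> [f M mf fM||h1 h2 _ [g1 s1 d1] _ [g2 s2 d2]|h1 h2 hs1 [g1 s1 d1] hs2 [g2 s2 d2]].
- exists (vmf_integral (fun x => kappa * x 0 i * f x)).
    exact: (vmf_smooth_int (mcoef kappa _ mf) (bcoef kappa _ _ fM)).
  by move=> c; exact: is_derive_vmf_integral fM.
(* The minus sign of d(1/N) is absorbed into the weight, as the class has no constructor for
   opposites. *)
- exists (vmf_integral (fun x => - kappa * x 0 i * 1) *
    ((fun c => (vmf_norm sigma kappa c)^-1) * (fun c => (vmf_norm sigma kappa c)^-1))).
    apply: vmf_smoothM; last exact: vmf_smoothM vmf_smooth_inv vmf_smooth_inv.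
    exact: (vmf_smooth_int (mcoef _ _ measurable1) (bcoef _ _ _ bounded1)).
  move=> c; have := is_derive_vmf_integral i c measurable1 bounded1.
  rewrite -vmf_norm_int => -[dN eN].
  apply: DeriveDef; first exact: derivableV.
  rewrite deriveV// eN !fctE [LHS]mulNr -mulrN mulrC expr2 invfM.
  congr (_ * _); rewrite /vmf_integral -mulN1r -RintegralZl//.
    by apply: eq_Rintegral => x _; ring.
  exact: (vmf_integrable _ sigma_ltoo _ (mcoef _ _ measurable1) (bcoef _ _ _ bounded1)).
- exists (g1 + g2); first exact: vmf_smoothD.
  by move=> c; exact: is_deriveD.
- exists (h1 * g2 + h2 * g1).
    by apply: vmf_smoothD; exact: vmf_smoothM.
  by move=> c; exact: is_deriveM.
Qed.

Lemma iter_partial_vmf_smooth g (l : seq 'I_m) :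
  vmf_smooth g -> vmf_smooth (iter_partial l g).
Proof.
move=> sg; elim: l => [//|i l IH] /=.
have [g' sg' dg'] := derive_vmf_smooth i IH.
suff -> : (fun x => 'D_(evec R i) (iter_partial l g) x) = g' by [].
by apply/funext => x; have [] := dg' x.
Qed.

Lemma smooth_on_vmf_smooth U g : vmf_smooth g -> smooth_on U g.
Proof.
move=> sg l; have sl := iter_partial_vmf_smooth l sg.
split=> [x _|i x _]; first exact: continuous_vmf_smooth.
by have [g' _ /(_ x)[]] := derive_vmf_smooth i sl.
Qed.

Lemma smooth_on_sphere_vmf_expect (f : V -> R) (M : R) :
  measurable_fun sph f -> (forall x, sph x -> `|f x| <= M) ->
  smooth_on_sphere (fun c : 'rV[R]_m => vmf_expect sigma kappa c f).
Proof.
move=> mf fM c sc.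
(* The same quotient makes sense on all of R^m, so it is its own smooth extension. *)
exists setT, ((fun c => (vmf_norm sigma kappa c)^-1) * vmf_integral f).
split=> //; first exact: openT.
apply: smooth_on_vmf_smooth; apply: vmf_smoothM; first exact: vmf_smooth_inv.
exact: vmf_smooth_int fM.
Qed.

End smooth.

(** * Contraction and fixed point *)

Lemma cvg_geometric0 (R : realType) (q B : R) :
  0 <= q -> q < 1 -> (fun n => q ^+ n * B) @ \oo --> (0 : R).
Proof.
move=> q0 q1; rewrite -[X in _ --> X](mul0r B).
by apply: cvgM; [apply: cvg_expr; rewrite ger0_norm|exact: cvg_cst].
Qed.

Lemma geometric_dist_cvg (R : realType) (q B l : R) (u : nat -> R) :
  0 <= q -> q < 1 -> (forall n, `|l - u n| <= q ^+ n * B) -> u @ \oo --> l.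
Proof.
move=> q0 q1 ul; have h := cvg_geometric0 B q0 q1.
apply/cvgrPdist_le => e e0; move/cvgrPdist_le : h => /(_ e e0).
apply: filterS => n; rewrite sub0r normrN => hn.
exact: le_trans (ul n) (le_trans (ler_norm _) hn).
Qed.

(** Increment bounds of this form telescope, so every later term lies within q^n B of u_n;
    convergence itself comes from monotonicity of a corrected sequence. *)
Lemma geometric_increments_cvg (R : realType) (q B : R) (u : nat -> R) :
  0 <= q -> q < 1 ->
  (forall n, `|u n.+1 - u n| <= (q ^+ n - q ^+ n.+1) * B) ->
  u @ \oo --> limn u /\ forall n, `|limn u - u n| <= q ^+ n * B.
Proof.
move=> q0 q1 du.
have B0 : 0 <= B.
  have := le_trans (normr_ge0 _) (du 0).
  by rewrite expr0 expr1 pmulr_rge0// subr_gt0.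
have dun n k : `|u (n + k)%N - u n| <= (q ^+ n - q ^+ (n + k)) * B.
  elim: k => [|k IH]; first by rewrite addn0 !subrr normr0 mul0r.
  rewrite addnS -(subrKA (u (n + k)%N)); apply: le_trans (ler_normD _ _) _.
  apply: le_trans (lerD (du _) IH) _.
  by rewrite -mulrDl addrC subrKA.
have dun' n k : `|u (n + k)%N - u n| <= q ^+ n * B.
  apply: le_trans (dun n k) _; rewrite ler_wpM2r// lerBlDr lerDl.
  exact: exprn_ge0.
(* u_n + q^n B is nonincreasing *)
have cu : cvgn u.
  have -> : u = (fun n => (u n + q ^+ n * B) - q ^+ n * B).
    by apply/funext => n; rewrite addrK.
  apply: is_cvgB; last by apply/cvg_ex; exists 0; exact: cvg_geometric0.
  apply: nonincreasing_is_cvgn.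
    apply/nonincreasing_seqP => n.
    have := le_trans (ler_norm _) (du n); lra.
  exists (u 0%N - B) => _ [n _ <-].
  have := dun' 0%N n; rewrite add0n expr0 mul1r ler_norml => /andP[h _].
  have : 0 <= q ^+ n * B by rewrite mulr_ge0 ?exprn_ge0.
  lra.
split=> // n.
(* The tail bound [dun'] passes to the limit in k. *)
have cv : `|u (k + n)%N - u n| @[k --> \oo] --> `|limn u - u n|.
  apply: cvg_norm; apply: cvgB; last exact: cvg_cst.
  by rewrite (cvg_shiftn n u).
apply: (cvgr_to_le cv); near=> k; rewrite addnC; exact: dun'.
Unshelve. all: by end_near. Qed.

(** * The sup norm on bounded measurable functions *)

Section sup_norm.
Variables (R : realType) (m : nat) (d : measure_display) (S : measurableType d).
Local Notation V := (mvec R m).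

Lemma normr_le_supnorm (Q : S * V -> R) s c :
  inB Q -> sphere c -> `|Q (s, c)| <= supnorm Q.
Proof.
move=> [_ [M QM]] sc; apply: sup_ubound; last by exists s => //; exists c.
by exists M => _ [t _ [b sb <-]]; exact: QM.
Qed.

(** The sphere is empty when m = 0, and [sup] of the empty set is 0; hence the condition on the sign
    of [M]. *)
Lemma supnorm_le (Q : S * V -> R) (M : R) : 0 <= M ->
  (forall s c, sphere c -> `|Q (s, c)| <= M) -> supnorm Q <= M.
Proof.
move=> M0 QM; rewrite /supnorm; set E := [set _ | _ in _ & _ in _].
have [->|/set0P E0] := eqVneq E set0; first by rewrite sup0.
by apply: ge_sup => // _ [t _ [b sb <-]]; exact: QM.
Qed.

Lemma supnorm_ge0 (Q : S * V -> R) : inB Q -> 0 <= supnorm Q.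
Proof.
move=> iQ; rewrite /supnorm; set E := [set _ | _ in _ & _ in _].
have [->|/set0P[_ [s _ [c sc _]]]] := eqVneq E set0; first by rewrite sup0.
exact: le_trans (normr_ge0 _) (normr_le_supnorm s iQ sc).
Qed.

Lemma inBB (Q1 Q2 : S * V -> R) :
  inB Q1 -> inB Q2 -> inB (fun sc => Q1 sc - Q2 sc).
Proof.
move=> [m1 [M1 b1]] [m2 [M2 b2]]; split; first exact: measurable_funB.
exists (M1 + M2) => s c sc; apply: le_trans (ler_normB _ _) _.
by rewrite lerD ?b1 ?b2.
Qed.

End sup_norm.

(** * The smoothed Bellman operator *)

Section bellman.
Variables (R : realType) (m : nat) (d : measure_display) (S : measurableType d).
Local Notation V := (mvec R m).
Local Notation sph := (@sphere R m : set V).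
Variable astar : S -> V -> action m.
Hypothesis astar_meas : forall a : action m,
  measurable [set sc : S * V | astar sc.1 sc.2 = a].
Variable r : S -> action m -> R.
Hypothesis r_meas : forall a, measurable_fun setT (fun s => r s a).
Hypothesis r_bd : exists M : R, forall s a, `|r s a| <= M.
Variable P : S -> action m -> probability S R.
Hypothesis P_meas : forall (a : action m) (B : set S), measurable B ->
  measurable_fun setT (fun s => P s a B).
Variable pi : S -> probability V R.
Hypothesis pi_meas : forall B : set V, measurable B ->
  measurable_fun setT (fun s => pi s B).
Variables (sigma : {measure set V -> \bar R}) (gamma kappa : R).
Hypothesis sigmaC0 : sigma (~` sph) = 0%E.
Hypothesis sigma_gt0 : (0 < sigma sph)%E.
Hypothesis sigma_ltoo : (sigma sph < +oo)%E.
Hypothesis gamma_ge0 : 0 <= gamma.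
Hypothesis gamma_lt1 : gamma < 1.

Local Notation T := (bellman sigma kappa astar r P pi gamma).

(** The integral runs over all of R^m, so the inner averages must be controlled at every c and not
    only on the sphere. *)
Definition policy_value (Q : S * V -> R) (s : S) : R :=
  \int[pi s]_(c in setT) vmf_expect sigma kappa c (fun x => Q (s, x)).

Definition next_value (Q : S * V -> R) (s : S) (a : action m) : R :=
  \int[P s a]_(s' in setT) policy_value Q s'.

(** The function f_Q of the factorization: all that stands inside the outer average. *)
Definition bellman_target (Q : S * V -> R) (sx : S * V) : R :=
  r sx.1 (astar sx.1 sx.2) + gamma * next_value Q sx.1 (astar sx.1 sx.2).

Lemma bellmanE (Q : S * V -> R) s c :
  T Q (s, c) = vmf_expect sigma kappa c (fun x => bellman_target Q (s, x)).
Proof. by []. Qed.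

Lemma normr_vmf_expect_inB_le (Q : S * V -> R) (M : R) s (c : V) :
  measurable_fun (setT `*` sph) Q ->
  (forall s c, sph c -> `|Q (s, c)| <= M) ->
  `|vmf_expect sigma kappa c (fun x => Q (s, x))| <= M.
Proof.
move=> mQ QM; apply: normr_vmf_expect_le => //; last by move=> x; exact: QM.
exact: measurable_xsection_sphere.
Qed.

Lemma measurable_policy_value (Q : S * V -> R) :
  measurable_fun (setT `*` sph) Q -> measurable_fun setT (policy_value Q).
Proof.
move=> mQ.
apply: (@measurable_Rintegral_finite_kernel _ _ _ _ _ (fun s => pi s) setT
  (fun sc => vmf_expect sigma kappa sc.2 (fun x => Q (sc.1, x)))) => //.
  (* Any constant above the total mass 1 would do. *)
  by exists 2 => s; rewrite [X in (X < _)%E]probability_setT lte_fin ltr1n.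
by apply: measurable_funTS; exact: measurable_vmf_expect.
Qed.

Lemma normr_policy_value_le (Q : S * V -> R) (M : R) s :
  measurable_fun (setT `*` sph) Q ->
  (forall s c, sph c -> `|Q (s, c)| <= M) -> `|policy_value Q s| <= M.
Proof.
move=> mQ QM; apply: normr_Rintegral_probability_le.
  exact: (measurableT_comp (measurable_vmf_expect _ sigmaC0 sigma_gt0 sigma_ltoo mQ) (pair1_measurable s)).
by move=> c; exact: normr_vmf_expect_inB_le.
Qed.

Lemma measurable_next_value (Q : S * V -> R) a : measurable_fun (setT `*` sph) Q ->
  measurable_fun setT (fun s => next_value Q s a).
Proof.
move=> mQ.
apply: (@measurable_Rintegral_finite_kernel _ _ _ _ _ (fun s => P s a) setT
  (fun ss => policy_value Q ss.2)) => //.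
- by move=> U mU; exact: P_meas.
- by exists 2 => s; rewrite [X in (X < _)%E]probability_setT lte_fin ltr1n.
- apply: measurable_funTS.
  by apply: (measurableT_comp (measurable_policy_value mQ)); exact: measurable_snd.
Qed.

Lemma normr_next_value_le (Q : S * V -> R) (M : R) s a :
  measurable_fun (setT `*` sph) Q ->
  (forall s c, sph c -> `|Q (s, c)| <= M) -> `|next_value Q s a| <= M.
Proof.
move=> mQ QM; apply: normr_Rintegral_probability_le.
  exact: measurable_policy_value.
by move=> s'; exact: normr_policy_value_le.
Qed.

(** The solver takes finitely many values, so f_Q is a finite sum over actions a of the indicator of
    {[astar] = a} times a function measurable in s. *)
Lemma measurable_bellman_target (Q : S * V -> R) : measurable_fun (setT `*` sph) Q ->
  measurable_fun setT (bellman_target Q).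
Proof.
move=> mQ; have -> : bellman_target Q = (fun sx => \sum_(a : action m)
    \1_[set sc : S * V | astar sc.1 sc.2 = a] sx *
    (r sx.1 a + gamma * next_value Q sx.1 a)).
  apply/funext => -[s x]; rewrite (bigD1 (astar s x))//= indicE mem_set//.
  rewrite mul1r big1 ?addr0// => a aE; rewrite indicE memNset ?mul0r//=.
  by move=> ae; rewrite ae eqxx in aE.
apply: measurable_sum => a; apply: measurable_funM; first exact: measurable_indic.
apply: (@measurableT_comp _ _ _ _ _ _
  (fun s => r s a + gamma * next_value Q s a)); last exact: measurable_fst.
apply: measurable_funD => //; apply: measurable_funM => //.
exact: measurable_next_value.
Qed.

Lemma bellman_target_bounded (Q : S * V -> R) : inB Q ->
  exists M : R, forall sx, `|bellman_target Q sx| <= M.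
Proof.
move=> [mQ [M QM]]; have [Mr rM] := r_bd; exists (Mr + gamma * M) => sx.
apply: le_trans (ler_normD _ _) _; rewrite lerD//.
by rewrite normrM ger0_norm// ler_wpM2l// normr_next_value_le.
Qed.

Lemma measurable_bellman_target_section (Q : S * V -> R) s : inB Q ->
  measurable_fun sph (fun x => bellman_target Q (s, x)).
Proof.
move=> [mQ _]; apply: measurable_funTS.
exact: (measurableT_comp (measurable_bellman_target mQ) (pair1_measurable s)).
Qed.

Lemma measurable_bellman (Q : S * V -> R) : inB Q -> measurable_fun setT (T Q).
Proof.
move=> [mQ _].
apply: (@measurable_vmf_expect _ _ _ _ sigmaC0 _ _ _ _ (bellman_target Q)) => //.
by apply: measurable_funTS; exact: measurable_bellman_target.
Qed.

Lemma bellman_bounded (Q : S * V -> R) : inB Q -> exists M : R, forall sc, `|T Q sc| <= M.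
Proof.
move=> iQ; have [M tM] := bellman_target_bounded iQ; exists M => -[s c].
by rewrite bellmanE; apply: normr_vmf_expect_le => //; exact: measurable_bellman_target_section.
Qed.

Lemma inB_bellman (Q : S * V -> R) : inB Q -> inB (T Q).
Proof.
move=> iQ; split; first by apply: measurable_funTS; exact: measurable_bellman.
by have [M TM] := bellman_bounded iQ; exists M => s c _; exact: TM.
Qed.

Lemma policy_value_dist_le (Q1 Q2 : S * V -> R) (D : R) s : inB Q1 -> inB Q2 ->
  (forall s c, sph c -> `|Q1 (s, c) - Q2 (s, c)| <= D) ->
  `|policy_value Q1 s - policy_value Q2 s| <= D.
Proof.
move=> [m1 [M1 b1]] [m2 [M2 b2]] QD.
have mv (Q : S * V -> R) (mQ : measurable_fun (setT `*` sph) Q) := measurableT_comp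
  (measurable_vmf_expect kappa sigmaC0 sigma_gt0 sigma_ltoo mQ) (pair1_measurable s).
apply: (@Rintegral_probability_dist_le _ _ _ _ _ _ M1 M2).
- exact: mv m1.
- by move=> c; exact: normr_vmf_expect_inB_le.
- exact: mv m2.
- by move=> c; exact: normr_vmf_expect_inB_le.
- move=> c; apply: (@vmf_expect_dist_le _ _ _ _ _ _ _ _ _ M1 M2) => //.
  + exact: measurable_xsection_sphere.
  + by move=> x; exact: b1.
  + exact: measurable_xsection_sphere.
  + by move=> x; exact: b2.
  + by move=> x; exact: QD.
Qed.

(** Both targets use the same action, so the rewards cancel and gamma factors out; the remaining
    averages are 1-Lipschitz. Closeness on the sphere gives closeness at every [sc], even off the
    sphere. *)
Lemma bellman_dist_le (Q1 Q2 : S * V -> R) (D : R) sc : inB Q1 -> inB Q2 ->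
  (forall s c, sph c -> `|Q1 (s, c) - Q2 (s, c)| <= D) ->
  `|T Q1 sc - T Q2 sc| <= gamma * D.
Proof.
case: sc => s c i1 i2 QD; rewrite !bellmanE.
have [M1 b1] := bellman_target_bounded i1.
have [M2 b2] := bellman_target_bounded i2.
apply: (@vmf_expect_dist_le _ _ _ _ _ _ _ _ _ M1 M2) => //.
- exact: measurable_bellman_target_section.
- exact: measurable_bellman_target_section.
move=> x _; rewrite /bellman_target /= opprD addrACA subrr add0r -mulrBr.
rewrite normrM ger0_norm// ler_wpM2l//.
have [m1 [N1 c1]] := i1; have [m2 [N2 c2]] := i2.
apply: (@Rintegral_probability_dist_le _ _ _ _ _ _ N1 N2).
- exact: measurable_policy_value.
- by move=> s'; exact: normr_policy_value_le.
- exact: measurable_policy_value.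
- by move=> s'; exact: normr_policy_value_le.
- by move=> s'; exact: policy_value_dist_le.
Qed.

Lemma bellman_contraction (Q1 Q2 : S * V -> R) : inB Q1 -> inB Q2 ->
  supnorm (fun sc => T Q1 sc - T Q2 sc)
    <= gamma * supnorm (fun sc => Q1 sc - Q2 sc).
Proof.
move=> i1 i2; have i12 := inBB i1 i2.
apply: supnorm_le => [|s c _]; first by rewrite mulr_ge0// supnorm_ge0.
apply: bellman_dist_le => // s' c' sc'.
exact: (normr_le_supnorm s' i12 sc').
Qed.

Lemma smooth_on_sphere_bellman (Q : S * V -> R) s : inB Q ->
  smooth_on_sphere (fun c : 'rV[R]_m => T Q (s, c)).
Proof.
move=> iQ; have [M tM] := bellman_target_bounded iQ.
apply: (@smooth_on_sphere_vmf_expect _ _ sigma kappa _ _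
  (fun x => bellman_target Q (s, x)) M) => //.
exact: measurable_bellman_target_section.
Qed.

(** Iterating the pointwise contraction bounds the difference by gamma^n (M1 + M2) for every n. *)
Lemma bellman_fixed_point_unique (Q1 Q2 : S * V -> R) : inB Q1 -> inB Q2 ->
  (forall s c, sph c -> T Q1 (s, c) = Q1 (s, c)) ->
  (forall s c, sph c -> T Q2 (s, c) = Q2 (s, c)) ->
  forall s c, sph c -> Q1 (s, c) = Q2 (s, c).
Proof.
move=> i1 i2 f1 f2; have [m1 [M1 b1]] := i1; have [m2 [M2 b2]] := i2.
have H n s c : sph c -> `|Q1 (s, c) - Q2 (s, c)| <= gamma ^+ n * (M1 + M2).
  elim: n s c => [|n IH] s c sc.
    rewrite expr0 mul1r; apply: le_trans (ler_normB _ _) _.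
    by rewrite lerD ?b1 ?b2.
  by rewrite -f1// -f2// exprS -mulrA; exact: bellman_dist_le.
move=> s c sc; apply/esym.
(* The constant sequence Q2(s, c) converges to Q1(s, c) as well as to itself. *)
have h := @geometric_dist_cvg _ _ _ _ (fun=> Q2 (s, c)) gamma_ge0 gamma_lt1
  (fun n => H n s c sc).
by apply: (@cvg_unique _ (@norm_hausdorff _ R) _ _ _ _ (cvg_cst _) h).
Qed.

(** The fixed point is a pointwise limit of iterates on all of S x R^m, which replaces completeness
    of the function space and yields the equation off the sphere too. *)
Lemma bellman_fixed_point : exists Q, inB Q /\ forall sc, T Q sc = Q sc.
Proof.
pose u n := iter n T (fun=> 0).
have iu n : inB (u n).
  elim: n => [|n IH]; last exact: inB_bellman.
  by split; [exact: measurable_cst|exists 0 => s c _; rewrite normr0].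
have [M uM] := bellman_bounded (iu 0%N).
(* Chosen so that gamma^n M = (gamma^n - gamma^(n+1)) B, the telescoping form. *)
pose B := M / (1 - gamma).
have BM : (1 - gamma) * B = M by rewrite mulrC divfK// gt_eqF// subr_gt0.
have du n sc : `|u n.+1 sc - u n sc| <= (gamma ^+ n - gamma ^+ n.+1) * B.
  have -> : (gamma ^+ n - gamma ^+ n.+1) * B = gamma ^+ n * M.
    by rewrite -BM exprS; ring.
  elim: n sc => [|n IH] sc; first by rewrite expr0 mul1r -[leLHS]/(`|T (u 0%N) sc - 0|) subr0.
  by rewrite exprS -mulrA; apply: (bellman_dist_le sc (iu n.+1) (iu n)) => s c _; exact: IH.
pose Q sc := limn (u ^~ sc).
have cvu sc := geometric_increments_cvg gamma_ge0 gamma_lt1 (fun n => du n sc).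
have iQ : inB Q.
  split.
    apply: (measurable_fun_cvg (h := u)) => [n|sc _]; first exact: (iu n).1.
    by have [] := cvu sc.
  (* The error bound at n = 0, where the iterate is 0, bounds the limit by [B]. *)
  exists B => s c _; have [_ /(_ 0%N)] := cvu (s, c).
  by rewrite expr0 mul1r subr0.
exists Q; split=> // sc.
have h1 : u n.+1 sc @[n --> \oo] --> Q sc.
  have [h _] := cvu sc; rewrite -(cvg_shiftS (u ^~ sc)) in h; exact: h.
(* The shifted iterates T u_n lie within gamma gamma^n B of T Q, so T Q and Q are limits of one
   sequence. *)
have h2 : u n.+1 sc @[n --> \oo] --> T Q sc.
  apply: (@geometric_dist_cvg _ gamma (gamma * B)) => // n.
  rewrite mulrCA; apply: (bellman_dist_le sc iQ (iu n)) => s c _.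
  by have [_ /(_ n)] := cvu (s, c).
exact: (@cvg_unique _ (@norm_hausdorff _ R) _ _ _ _ h2 h1).
Qed.

End bellman.

Unset Implicit Arguments.

Theorem theorem1 (R : realType) (m : nat) (d : measure_display)
  (S : measurableType d)
  (* feasible action sets: finite (subsets of {0,1}^m) and nonempty *)
  (Afeas : S -> {set action m})
  (hA : forall s, exists a, a \in Afeas s)
  (* solver with deterministic, measurable tie-breaking *)
  (astar : S -> mvec R m -> action m)
  (hastar : forall s c, astar s c \in Afeas s /\
     (forall a, a \in Afeas s -> dotv c (actv R (astar s c)) <= dotv c (actv R a)))
  (hastar_meas : forall a : action m,
     measurable [set sc : S * mvec R m | astar sc.1 sc.2 = a])
  (* bounded measurable reward *)
  (r : S -> action m -> R)
  (hr_meas : forall a, measurable_fun setT (fun s => r s a))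
  (hr_bd : exists M : R, forall s a, `|r s a| <= M)
  (* measurable transition kernel *)
  (P : S -> action m -> probability S R)
  (hP : forall (a : action m) (B : set S), measurable B ->
     measurable_fun setT (fun s => P s a B))
  (* measurable policy kernel into the sphere *)
  (pi : S -> probability (mvec R m) R)
  (hpi : forall B : set (mvec R m), measurable B ->
     measurable_fun setT (fun s => pi s B))
  (hpi_sph : forall s, pi s (@sphere R m : set (mvec R m)) = 1%E)
  (* surface measure on the sphere (up to a positive constant) *)
  (sigma : {measure set mvec R m -> \bar R})
  (hsigma : surface_measure_like sigma)
  (gamma kappa : R) (hgamma0 : 0 <= gamma) (hgamma1 : gamma < 1)
  (hkappa : 0 < kappa) :
  let T := bellman sigma kappa astar r P pi gamma in
  (* (1) T maps B_infty into itself and is a gamma-contraction *)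
  (forall Q, inB Q -> inB (T Q)) /\
  (forall Q1 Q2, inB Q1 -> inB Q2 ->
     supnorm (fun sc => T Q1 sc - T Q2 sc)
       <= gamma * supnorm (fun sc => Q1 sc - Q2 sc)) /\
  (* (1)+(3) unique fixed point Q_kappa^pi, smooth in c *)
  (exists Qk, inB Qk /\
     (forall s c, @sphere R m c -> T Qk (s, c) = Qk (s, c)) /\
     (forall Q, inB Q -> (forall s c, @sphere R m c -> T Q (s, c) = Q (s, c)) ->
        forall s c, @sphere R m c -> Q (s, c) = Qk (s, c)) /\
     (forall s, smooth_on_sphere (fun c : 'rV[R]_m => Qk (s, c)))) /\
  (* (2) smoothing *)
  (forall Q, inB Q -> forall s,
     smooth_on_sphere (fun c : 'rV[R]_m => T Q (s, c))).
Proof.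
have [sC0 s_gt0 s_ltoo _] := hsigma.
move=> T; split; first by move=> Q; exact: inB_bellman.
split; first by move=> Q1 Q2; exact: bellman_contraction.
split; last by move=> Q iQ s; exact: smooth_on_sphere_bellman.
have [Qk [iQk fQk]] : exists Q, inB Q /\ forall sc, T Q sc = Q sc.
  exact: bellman_fixed_point.
exists Qk; split=> //; split; first by move=> s c _; exact: fQk.
split=> [Q iQ fQ|s].
  by apply: (bellman_fixed_point_unique hastar_meas hr_meas hr_bd hP hpi sC0 s_gt0 s_ltoo hgamma0 hgamma1 iQ iQk fQ) => s c _; exact: fQk.
(* Since the fixed-point equation holds at every c, this is an equality of functions on R^m, and
   smoothness of T Qk carries over. *)
have -> : (fun c : 'rV[R]_m => Qk (s, c)) = (fun c => T Qk (s, c)).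
  by apply/funext => c; rewrite fQk.
exact: smooth_on_sphere_bellman.
Qed.
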